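(* Let $\kappa\ge1$, let $\xi=(\xi_x)_{x\in\mathbb{N}}$ be any sequence in $\{0,1,\dots,\kappa\}$, and let $\mathcal{C}_e=\{\alpha_1<\dots<\alpha_r\}\subseteq\{1,\dots,\kappa\}$ with $r\ge1$. Let $(W_x)_{x\ge0}$ be the carrier process over $\xi$ and $(X_x)_{x\ge0}$ the decoupled carrier process over $\xi$ associated with $\mathcal{C}_e$, both started at $W_0=X_0=\mathbf{0}$. Let $R$ be the $\kappa\times\kappa$ matrix with $1$ on the diagonal, $-1$ on the superdiagonal and $0$ elsewhere, and let $(Y_x)_{x\ge0}$ be the pushing process defined in the context. Then (i) $W_x=X_x+RY_x$ for all $x\ge0$; (ii) $Y_0=\mathbf{0}$ and for each $i\in\{1,\dots,\kappa\}$ the $i$-th coordinate of $Y_x$ is non-decreasing in $x$ and can only increase when $W_x(i)=0$, i.e. $\sum_{x\ge0}\mathbf{1}(W_x(i)\ge1)\,(Y_{x+1}(i)-Y_x(i))=0$.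
   Context: Notation: $\mathbb{N}=\{1,2,\dots\}$; $\mathbf{e}_i$ is the $i$-th standard basis vector of $\mathbb{Z}^\kappa$, $\mathbf{e}_0=\mathbf{e}_{\kappa+1}:=\mathbf{0}$; $\alpha_{r+1}:=\kappa+1$. Put $i:=\xi_{x+1}$ if $\xi_{x+1}\ge1$ and $i:=\kappa+1$ if $\xi_{x+1}=0$. Carrier process on $\mathbb{Z}_{\ge0}^\kappa$: $W_{x+1}=W_x+\mathbf{e}_i-\mathbf{e}_{y_W}$, where $y_W=y_W(x):=\max\{1\le q<i:W_x(q)\ge1\}$, or $0$ if there is no such $q$ (the color excluded from $W_x$). Decoupled carrier process associated with $\mathcal{C}_e$, on $\{x\in\mathbb{Z}^\kappa:x_q\ge0\text{ if }q\notin\mathcal{C}_e\}$: $X_{x+1}=X_x+\mathbf{e}_i-\mathbf{e}_{y_X}$, where $y_X=y_X(x)$ is the following color. If $1\le i\le\alpha_1$: $y_X:=\max\{1\le q<i:X_x(q)\ge1\}$, or $0$ if there is no such $q$. If $\alpha_j<i\le\alpha_{j+1}$ with $1\le j\le r$: $y_X:=\max\{q:\alpha_j<q<i,\ X_x(q)\ge1\}$ if this set is nonempty, and $y_X:=\alpha_j$ otherwise. Pushing process: $Y_0=\mathbf{0}$ and $Y_{x+1}-Y_x:=\mathbf{e}_{y_W+1}+\mathbf{e}_{y_W+2}+\dots+\mathbf{e}_{y_X}$ if $y_W<y_X$, and $Y_{x+1}-Y_x:=\mathbf{0}$ if $y_W=y_X$ (it is always the case that $y_W\le y_X$; an empty sum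 is $\mathbf{0}$). *)

(* Defs.v *)
From mathcomp Require Import all_boot all_order all_algebra.

Set Implicit Arguments.
Unset Strict Implicit.
Unset Printing Implicit Defensive.

Import Order.TTheory GRing.Theory Num.Theory.

Local Open Scope ring_scope.

(* Colors are the natural numbers 1, ..., kappa; color q is stored at index
   q - 1 of a vector, so that k : 'I_kappa stands for the color k.+1. *)

(* In particular unitv 0 = unitv kappa.+1 = 0. *)
Definition unitv (kappa q : nat) : 'cV[int]_kappa :=
  \col_(k < kappa) (k.+1 == q)%:R.

(* max {q | a < q < b, v(q) >= 1}, and 0 if there is no such q (colors are
   positive, so the value 0 occurs only in that case). *)
Definition max_color (kappa : nat) (v : 'cV[int]_kappa) (a b : nat) : nat :=
  (\max_(k < kappa | (a < k.+1 < b)%N && (1 <= v k ord0)%R) k.+1)%N.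

(* The input sequence xi is indexed by {1, 2, ...}; xi 0 is never used. *)
Definition inserted (kappa : nat) (xi : nat -> 'I_kappa.+1) (x : nat) : nat :=
  if (1 <= xi x.+1)%N then xi x.+1 : nat else kappa.+1.

(* alpha = [:: alpha_1; ...; alpha_r] lists the exceptional colors in
   increasing order. exc alpha j is alpha_j for 1 <= j <= r, and kappa + 1 for
   j = r + 1; the entry at j = 0 is a placeholder. *)
Definition exc (kappa : nat) (alpha : seq nat) (j : nat) : nat :=
  nth kappa.+1 (0%N :: alpha) j.

(* The index j with alpha_j < i <= alpha_(j+1), or 0 if i <= alpha_1. *)
Definition block (alpha : seq nat) (i : nat) : nat :=
  find (fun a => i <= a)%N alpha.

Lemma blockE (kappa : nat) (alpha : seq nat) (i j : nat) :
    sorted ltn alpha -> (1 <= j <= size alpha)%N ->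
    (exc kappa alpha j < i <= exc kappa alpha j.+1)%N ->
  block alpha i = j.
Proof.
case: j => // j; rewrite /exc /block /= => sa jr /andP[lt_ji le_ij].
have before k : (k <= j)%N -> (nth kappa.+1 alpha k < i)%N.
  move=> kj; apply: leq_ltn_trans lt_ji.
  case: (ltngtP k j) kj => // [kj _|-> //]; apply: ltnW.
  by apply: (sorted_ltn_nth ltn_trans) => //; rewrite inE // (ltn_trans kj).
apply/eqP; rewrite eqn_leq; apply/andP; split.
  case: (ltnP j.+1 (size alpha)) => [j1r|]; last exact: leq_trans (find_size _ _).
  by rewrite leqNgt; apply/negP => /(before_find kappa.+1); rewrite le_ij.
rewrite ltnNge; apply/negP => fj.
have hasi : has (fun a => i <= a)%N alpha by rewrite has_find (leq_ltn_trans fj).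
by have := nth_find kappa.+1 hasi; rewrite leqNgt before.
Qed.

(* The excluded color y_W when i is inserted in state v. *)
Definition excluded (kappa : nat) (v : 'cV[int]_kappa) (i : nat) : nat :=
  max_color v 0 i.

(* The excluded color y_X when i is inserted in state v. *)
Definition dec_excluded (kappa : nat) (alpha : seq nat) (v : 'cV[int]_kappa)
    (i : nat) : nat :=
  if (i <= exc kappa alpha 1)%N then max_color v 0 i
  else let a := exc kappa alpha (block alpha i) in
       let m := max_color v a i in
       if (1 <= m)%N then m else a.

Fixpoint carrier (kappa : nat) (xi : nat -> 'I_kappa.+1) (w0 : 'cV[int]_kappa)
    (x : nat) : 'cV[int]_kappa :=
  if x is x'.+1 then
    let w := carrier xi w0 x' in
    let i := inserted xi x' in
    w + unitv kappa i - unitv kappa (excluded w i)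
  else w0.

Fixpoint dec_carrier (kappa : nat) (alpha : seq nat) (xi : nat -> 'I_kappa.+1)
    (v0 : 'cV[int]_kappa) (x : nat) : 'cV[int]_kappa :=
  if x is x'.+1 then
    let v := dec_carrier alpha xi v0 x' in
    let i := inserted xi x' in
    v + unitv kappa i - unitv kappa (dec_excluded alpha v i)
  else v0.

Fixpoint pushing (kappa : nat) (alpha : seq nat) (xi : nat -> 'I_kappa.+1)
    (W X : nat -> 'cV[int]_kappa) (x : nat) : 'cV[int]_kappa :=
  if x is x'.+1 then
    let i := inserted xi x' in
    let yW := excluded (W x') i in
    let yX := dec_excluded alpha (X x') i in
    pushing alpha xi W X x' + \sum_(yW.+1 <= q < yX.+1) unitv kappa q
  else 0.

Definition reflection_mx (kappa : nat) : 'M[int]_kappa :=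
  \matrix_(p < kappa, q < kappa)
    ((p == q)%:R - (q == p.+1 :> nat)%:R).

(* Main.v *)
Require Import Defs.
From HB Require Import structures.
From mathcomp Require Import all_boot all_order all_algebra.
From mathcomp Require Import all_classical all_reals all_analysis.
From mathcomp Require Import zify.
From mathcomp Require Import zify.

(** Write y_W and y_X for the colors excluded from the two carriers in a given
    step, with the same color i inserted into both.

    The rule defining y_X by cases is a maximum in disguise: y_X is the largest
    color below i that is exceptional or present in X
    ([dec_excluded_bigmax]).  It differs from the rule for y_W only in that
    exceptional colors always count as available.

    Hence everything follows from one invariant, [carrier_le_dec_carrier]:
    W_x(q) <= X_x(q) for every nonexceptional color q.  It makes every color
    available to W also available to X, so y_W <= y_X.  It is preserved because
    W - X changes by e_(y_X) - e_(y_W), and it could only fail at a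
    nonexceptional color y_X > y_W; by maximality of y_W that color is absent
    from W, while it is present in X, so the inequality was strict there.

    Given y_W <= y_X, the identity W = X + RY is a telescoping sum, since
    R e_q = e_q - e_(q-1).  A coordinate of Y increases only at the colors q
    with y_W < q <= y_X < i, and these are absent from W by maximality
    of y_W. *)

Set Implicit Arguments.
Unset Strict Implicit.
Unset Printing Implicit Defensive.

Import Order.TTheory GRing.Theory Num.Theory.
Import numFieldNormedType.Exports.

Local Open Scope classical_set_scope.
Local Open Scope ring_scope.

Lemma bigmax_ordS_attained (n : nat) (P : pred 'I_n) :
  (0 < \max_(k < n | P k) k.+1)%N ->
  exists2 k : 'I_n, P k & (\max_(k < n | P k) k.+1)%N = k.+1.
Proof.
move=> max_gt0.
have P_gt0 : (0 < #|P|)%N.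
  rewrite lt0n; apply/eqP => P0; move: max_gt0.
  by rewrite big_pred0 // => k; exact: (card0_eq P0 k).
have [k Pk ->] := eq_bigmax_cond (fun k : 'I_n => k.+1) P_gt0.
by exists k.
Qed.

Lemma excluded_attained (kappa : nat) (v : 'cV[int]_kappa) (i : nat)
    (k : 'I_kappa) :
  k.+1 = excluded v i -> 1 <= v k ord0.
Proof.
rewrite /excluded /max_color => Ek.
have [|l /andP[_ vl] El] := bigmax_ordS_attained
    (P := fun k : 'I_kappa => (0 < k.+1 < i)%N && (1 <= v k ord0)).
  by rewrite -Ek.
by suff -> : k = l by []; apply: val_inj; move: Ek; rewrite El => -[].
Qed.

Lemma leq_excluded (kappa : nat) (v : 'cV[int]_kappa) (i : nat)
    (k : 'I_kappa) :
  (k.+1 < i)%N -> 1 <= v k ord0 -> (k.+1 <= excluded v i)%N.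
Proof.
move=> ki vk; rewrite /excluded /max_color.
by apply: (leq_bigmax_cond (F := fun k : 'I_kappa => k.+1)); rewrite ki vk.
Qed.

(** The search defining [block] stops at the first exceptional color that is at
    least i.  Prepending 0 to the list in [exc] shifts the indices by one, so
    that the same index points to the entry just before it. *)
Lemma exc_block (kappa : nat) (alpha : seq nat) (i : nat) :
    sorted ltn alpha -> (1 <= size alpha)%N -> (exc kappa alpha 1 < i)%N ->
  let a := exc kappa alpha (block alpha i) in
  [/\ a \in alpha, (a < i)%N
    & forall c, c \in alpha -> (c < i)%N -> (c <= a)%N].
Proof.
move=> sa sz_gt0; rewrite /exc /block /= => head_lt.
have b_gt0 : (0 < find (fun a => i <= a)%N alpha)%N.
  rewrite lt0n; apply/eqP => b0.
  have hasi : has (fun a => i <= a)%N alpha by rewrite has_find b0.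
  by have := nth_find kappa.+1 hasi; rewrite b0 leqNgt head_lt.
case Eb: (find _ alpha) b_gt0 => [//|b] _ /=.
have b_lt : (b < size alpha)%N by rewrite -Eb find_size.
split; first exact: mem_nth.
  by rewrite ltnNge; apply/negbT/(before_find kappa.+1 (a := leq i)); rewrite Eb.
move=> c c_in c_lt.
have sa_leq : sorted leq alpha by apply: sub_sorted sa => x y /ltnW.
have mono := sorted_leq_nth leq_trans leqnn kappa.+1 sa_leq.
have idx_lt : (index c alpha < size alpha)%N by rewrite index_mem.
have idx_le : (index c alpha <= b)%N.
  rewrite leqNgt; apply/negP => b_idx.
  have b1_lt : (b.+1 < size alpha)%N by exact: leq_ltn_trans b_idx idx_lt.
  have hasi : has (fun a => i <= a)%N alpha by rewrite has_find Eb.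
  have := nth_find kappa.+1 hasi; rewrite Eb leqNgt => /negP; apply.
  apply: leq_ltn_trans c_lt.
  by rewrite -(nth_index kappa.+1 c_in); apply: mono; rewrite ?inE.
by rewrite -(nth_index kappa.+1 c_in); apply: mono; rewrite ?inE.
Qed.

(** The decoupled rule treats exceptional colors as if they were always present:
    if i <= alpha_1 there is none below i, and past alpha_j the largest one
    below i is alpha_j, which is used only if nothing above it is present. *)
Lemma dec_excluded_bigmax (kappa : nat) (alpha : seq nat) (v : 'cV[int]_kappa)
    (i : nat) :
    sorted ltn alpha -> (forall a, a \in alpha -> (1 <= a <= kappa)%N) ->
    (1 <= size alpha)%N ->
  dec_excluded alpha v i =
  (\max_(k < kappa | (k.+1 < i) && ((k.+1 \in alpha) || (1 <= v k ord0)%R))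
     k.+1)%N.
Proof.
move=> sa colors sz_gt0; rewrite /dec_excluded.
case: (leqP i) => [i_le|i_gt].
  apply: eq_bigl => k /=; case: (ltnP k.+1 i) => //= ki.
  suff -> : (k.+1 \in alpha) = false by [].
  apply/negP => k_in.
  have sa_leq : sorted leq alpha by apply: sub_sorted sa => x y /ltnW.
  have : (exc kappa alpha 1 <= k.+1)%N.
    rewrite /exc /= -(nth_index kappa.+1 k_in).
    by apply: (sorted_leq_nth leq_trans leqnn); rewrite ?inE ?index_mem.
  by rewrite leqNgt (leq_trans ki).
have [] := exc_block sa sz_gt0 i_gt.
set a := exc _ _ _ => a_in a_lt a_max.
set m := max_color v a i.
transitivity (maxn a m).
  case: (posnP m) => [->|m_gt0]; first by rewrite maxn0.
  have [k /andP[/andP[ak _] _] Em] := bigmax_ordS_attained m_gt0.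
  by rewrite (maxn_idPr _) // /m /max_color Em ltnW.
apply/eqP; rewrite eqn_leq; apply/andP; split.
  rewrite geq_max; apply/andP; split.
    have /andP[a_gt0 a_le] := colors a a_in.
    have a1_lt : (a.-1 < kappa)%N by rewrite prednK.
    have Ea : (Ordinal a1_lt).+1 = a by rewrite /= prednK.
    rewrite -[X in (X <= _)%N]Ea.
    apply: (leq_bigmax_cond (F := fun k : 'I_kappa => k.+1)).
    by rewrite Ea a_lt a_in.
  apply/bigmax_leqP => k /andP[/andP[_ ki] vk].
  apply: (leq_bigmax_cond (F := fun k : 'I_kappa => k.+1)).
  by rewrite ki vk orbT.
apply/bigmax_leqP => k /andP[ki avail]; rewrite leq_max.
case: (leqP k.+1 a) => //= ak.
apply: (leq_bigmax_cond (F := fun k : 'I_kappa => k.+1)); rewrite ak ki /=.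
by case/orP: avail => // k_in; have := a_max _ k_in ki; rewrite leqNgt ak.
Qed.

Lemma inserted_gt0 (kappa : nat) (xi : nat -> 'I_kappa.+1) (x : nat) :
  (0 < inserted xi x)%N.
Proof. by rewrite /inserted; case: ifP. Qed.

Lemma carrier_ge0 (kappa : nat) (xi : nat -> 'I_kappa.+1)
    (w0 : 'cV[int]_kappa) :
    (forall k, 0 <= w0 k ord0) ->
  forall x k, 0 <= carrier xi w0 x k ord0.
Proof.
move=> w0_ge0; elim=> [|x IHx] k //=; rewrite !mxE.
have Wk := IHx k.
case: (eqVneq k.+1 (excluded _ _)) => [/excluded_attained|_] /=;
  case: (_ == _) => /=; lia.
Qed.

Lemma excluded_le_dec_excluded (kappa : nat) (alpha : seq nat)
    (w v : 'cV[int]_kappa) (i : nat) :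
    sorted ltn alpha -> (forall a, a \in alpha -> (1 <= a <= kappa)%N) ->
    (1 <= size alpha)%N ->
    (forall k : 'I_kappa, k.+1 \notin alpha -> w k ord0 <= v k ord0) ->
  (excluded w i <= dec_excluded alpha v i)%N.
Proof.
move=> sa colors sz_gt0 le_wv; rewrite dec_excluded_bigmax //.
apply/bigmax_leqP => k /andP[/andP[_ ki] wk].
apply: (leq_bigmax_cond (F := fun k : 'I_kappa => k.+1)); rewrite ki /=.
by case: (boolP (_ \in _)) => //= /le_wv; apply: le_trans.
Qed.

Lemma dec_excluded_lt (kappa : nat) (alpha : seq nat) (v : 'cV[int]_kappa)
    (i : nat) :
    sorted ltn alpha -> (forall a, a \in alpha -> (1 <= a <= kappa)%N) ->
    (1 <= size alpha)%N ->
  (0 < i)%N -> (dec_excluded alpha v i < i)%N.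
Proof.
move=> sa colors sz_gt0 i_gt0.
rewrite dec_excluded_bigmax // -[ltnRHS](prednK i_gt0) ltnS.
by apply/bigmax_leqP => k /andP[ki _]; rewrite -ltnS prednK.
Qed.

Lemma dec_excluded_attained (kappa : nat) (alpha : seq nat)
    (v : 'cV[int]_kappa) (i : nat) (k : 'I_kappa) :
    sorted ltn alpha -> (forall a, a \in alpha -> (1 <= a <= kappa)%N) ->
    (1 <= size alpha)%N ->
    k.+1 = dec_excluded alpha v i -> k.+1 \notin alpha -> 1 <= v k ord0.
Proof.
move=> sa colors sz_gt0; rewrite dec_excluded_bigmax // => Ek k_notin.
have [|l /andP[_ avail] El] := bigmax_ordS_attained
    (P := fun k : 'I_kappa =>
       (k.+1 < i)%N && ((k.+1 \in alpha) || (1 <= v k ord0))).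
  by rewrite -Ek.
have El' : l = k by apply: val_inj; move: Ek; rewrite El => -[].
by move: avail; rewrite El' (negPf k_notin).
Qed.

(** A step changes w - v by e_(y_X) - e_(y_W), so the inequality is endangered
    only at the color y_X when y_W < y_X.  If that color is nonexceptional, it
    is present in v but, by maximality of y_W, not in w.  At exceptional colors
    the inequality can fail, because there y_X need not be present in v. *)
Lemma carrier_le_dec_carrier (kappa : nat) (xi : nat -> 'I_kappa.+1)
    (alpha : seq nat) (w0 v0 : 'cV[int]_kappa) :
    sorted ltn alpha -> (forall a, a \in alpha -> (1 <= a <= kappa)%N) ->
    (1 <= size alpha)%N ->
    (forall k : 'I_kappa, k.+1 \notin alpha -> w0 k ord0 <= v0 k ord0) ->
  forall (x : nat) (k : 'I_kappa), k.+1 \notin alpha ->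
    carrier xi w0 x k ord0 <= dec_carrier alpha xi v0 x k ord0.
Proof.
move=> sa colors sz_gt0 le0; elim=> [|x IHx] k k_notin /=; first exact: le0.
set i := inserted xi x; set w := carrier xi w0 x.
set v := dec_carrier alpha xi v0 x.
have le_wv : w k ord0 <= v k ord0 by exact: IHx.
have le_y : (excluded w i <= dec_excluded alpha v i)%N.
  exact: excluded_le_dec_excluded.
rewrite !mxE.
(* Arithmetic settles every case but k.+1 = y_X <> y_W. *)
case: (eqVneq k.+1 (excluded w i)) => [_|neW];
  case: (eqVneq k.+1 (dec_excluded alpha v i)) => [EX|_] /=; try lia.
have vk := dec_excluded_attained sa colors sz_gt0 EX k_notin.
have ki : (k.+1 < i)%N by rewrite EX dec_excluded_lt // inserted_gt0.
suff : ~~ (1 <= w k ord0) by lia.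
by apply/negP => /(leq_excluded ki); lia.
Qed.

Lemma sum_unitv (kappa a b : nat) (k : 'I_kappa) :
  (\sum_(a.+1 <= q < b.+1) unitv kappa q) k ord0 = (a < k.+1 <= b)%:R.
Proof.
rewrite summxE (eq_bigr (fun q => if q == k.+1 then 1 else 0 : int)); last first.
  by move=> q _; rewrite mxE eq_sym; case: eqP.
rewrite -big_mkcond big_nat1_eq //=.
by rewrite ltnS; case: ifP.
Qed.

Lemma reflection_unitv (kappa q : nat) :
    (q.+1 <= kappa)%N ->
  reflection_mx kappa *m unitv kappa q.+1 = unitv kappa q.+1 - unitv kappa q.
Proof.
move=> q_lt; apply/colP => p; rewrite !mxE (bigD1 (Ordinal q_lt)) //=.
rewrite !mxE /= eqxx mulr1 big1 => [|l l_neq]; last first.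
  rewrite !mxE eqSS; have -> : (l == q :> nat) = false; last by rewrite mulr0.
  by apply/negbTE; apply: contraNneq l_neq => El; apply/eqP/val_inj.
by rewrite addr0 eqSS [q == p.+1]eq_sym -val_eqE.
Qed.

Lemma reflection_sum_unitv (kappa a b : nat) :
    (a <= b <= kappa)%N ->
  reflection_mx kappa *m (\sum_(a.+1 <= q < b.+1) unitv kappa q) =
    unitv kappa b - unitv kappa a.
Proof.
case/andP=> ab b_le; rewrite big_add1 /= mulmx_sumr -telescope_sumr //.
rewrite !big_nat; apply: eq_bigr => q /andP[_ qb].
by rewrite reflection_unitv // (leq_trans qb).
Qed.

Theorem lemma6p3 (R : realType) (kappa : nat) (xi : nat -> 'I_kappa.+1)
    (alpha : seq nat)
    (kappa_gt0 : (1 <= kappa)%N)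
    (alpha_sorted : sorted ltn alpha)
    (alpha_color : forall a : nat, a \in alpha -> (1 <= a <= kappa)%N)
    (alpha_gt0 : (1 <= size alpha)%N) :
  let W := carrier xi 0 in
  let X := dec_carrier alpha xi 0 in
  let Y := pushing alpha xi W X in
  (forall x : nat, W x = X x + reflection_mx kappa *m Y x) /\
  (Y 0%N = 0 /\
   forall i : 'I_kappa,
     [/\ nondecreasing_seq (fun x : nat => Y x i ord0),
         forall x : nat, Y x i ord0 < Y x.+1 i ord0 -> W x i ord0 = 0 &
         series (fun x : nat =>
           ((1 <= W x i ord0)%R%:R * (Y x.+1 i ord0 - Y x i ord0))%:~R : R)
           @ \oo --> (0 : R)]).
Proof.
move=> W X Y.
pose yW x := excluded (W x) (inserted xi x).
pose yX x := dec_excluded alpha (X x) (inserted xi x).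
have yX_lt x : (yX x < inserted xi x)%N by rewrite dec_excluded_lt ?inserted_gt0.
have W_ge0 x k : 0 <= W x k ord0 by apply: carrier_ge0 => l; rewrite mxE.
have stepY x k : Y x.+1 k ord0 = Y x k ord0 + (yW x < k.+1 <= yX x)%:R.
  by rewrite -sum_unitv /= mxE.
have pushed_absent x (k : 'I_kappa) : (yW x < k.+1 <= yX x)%N -> W x k ord0 = 0.
  case/andP=> Wk kX; have ki := leq_ltn_trans kX (yX_lt x).
  suff : ~~ (1 <= W x k ord0) by have := W_ge0 x k; lia.
  by apply/negP => /(leq_excluded ki); rewrite leqNgt Wk.
split; last (split=> // k; split).
- elim=> [|x IHx]; first by rewrite /= mulmx0 addr0.
  have le_y : (yW x <= yX x)%N.
    by apply: excluded_le_dec_excluded => // l; apply: carrier_le_dec_carrier.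
  have yX_le : (yX x <= kappa)%N.
    apply: leq_trans (_ : (inserted xi x).-1 <= kappa)%N.
      by rewrite -ltnS prednK ?inserted_gt0.
    by rewrite /inserted; case: ifP => // _; have := ltn_ord (xi x.+1); lia.
  rewrite /W /X /Y /= -/(W x) -/(X x) -/(Y x) -/(yW x) -/(yX x).
  rewrite mulmxDr reflection_sum_unitv ?le_y // IHx.
  by apply/colP => p; rewrite !mxE; lia.
- by apply/nondecreasing_seqP => x; rewrite stepY lerDl; case: (_ && _).
- move=> x; rewrite stepY ltrDl => pushed; apply: pushed_absent.
  by move: pushed; case: (_ && _).
- have term0 : (fun x : nat =>
      ((1 <= W x k ord0)%R%:R * (Y x.+1 k ord0 - Y x k ord0))%:~R : R) = cst 0.
    apply/funext => x /=; rewrite stepY addrAC subrr add0r.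
    case: (boolP (_ && _)) => [/pushed_absent ->|_]; last by rewrite mulr0.
    by rewrite mul0r.
  rewrite term0 (_ : series _ = cst 0); first exact: cvg_cst.
  by apply/funext => n; rewrite /series /= big1.
Qed.
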